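(* Let $\mathcal{C}\subseteq\mathbb{N}^d$ be a positive integer cone and let $S$ be a UESY-semigroup, i.e. $S=T\cup\{\operatorname{F}(T)\}$ for some symmetric $\mathcal{C}$-semigroup $T$. Then $S$ is primary positioned.
   Context: Let $d\geq 1$. For a finite set $A\subseteq\mathbb{N}^d$, the positive integer cone spanned by $A$ is $\mathcal{C}=\{\sum_{i=1}^n q_ia_i : n\in\mathbb{N}, a_i\in A, q_i\in\mathbb{Q}_{\geq0}\}\cap\mathbb{N}^d$. A $\mathcal{C}$-semigroup is a finitely generated submonoid $S$ of $(\mathbb{N}^d,+)$ with $S\subseteq\mathcal{C}$ and $\mathcal{C}\setminus S$ finite. Put $\mathcal{H}(S)=\mathcal{C}\setminus S$. For $x,y$ write $x\leq_{\mathcal{C}}y$ iff $y-x\in\mathcal{C}$. For $k\in\mathcal{C}$ let $\operatorname{I}_{\mathcal{C}}(k)=\{x\in\mathcal{C}: x\leq_{\mathcal{C}}k\}$. $S$ is $k$-positioned if $k-h\in S$ for every $h\in\mathcal{H}(S)$. Define $\operatorname{C}(S)=\{x\in\mathcal{C}: x\leq_{\mathcal{C}}h\text{ for some }h\in\mathcal{H}(S)\}$ and $\operatorname{M}(S)=\{h\in\mathcal{H}(S): \{s\in S: h-s\in S\}=\{0\}\}\cup\{0\}$. $S$ is primary positioned (for $k$) if there is $k\in\mathcal{C}$ such that $S$ is $k$-positioned and $|\operatorname{M}(S)|+|\operatorname{C}(S)|=|\operatorname{I}_{\mathcal{C}}(k)|$. A term order $\preceq$ on $\mathbb{N}^d$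 is a total order with $0\preceq v$ for all $v$ and $u\preceq v\Rightarrow u+w\preceq v+w$. The Frobenius element is $\operatorname{F}_\preceq(S)=\max_\preceq\mathcal{H}(S)$. The pseudo-Frobenius set is $\operatorname{PF}(S)=\{x\in\mathcal{H}(S): x+(S\setminus\{0\})\subseteq S\}$. $S$ is symmetric if $\operatorname{PF}(S)=\{\operatorname{F}_\preceq(S)\}$ for a term order $\preceq$; in that case the Frobenius element does not depend on the term order and is denoted $\operatorname{F}(S)$.
   Formalization: In M(S) the condition h−s∈S is replaced by h−s∈C (i.e. s ≤_C h): as printed, no gap h satisfies it, so M(S)={0} and the claim fails, e.g. for C=N, T=<3,4>, S={0,3,4,...}. *)

(* Defs.v *)
From mathcomp Require Import all_boot all_order all_algebra.
From mathcomp Require Import finmap.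
From mathcomp Require Import mathcomp_extra boolp classical_sets functions.
From mathcomp Require Import cardinality.

Set Implicit Arguments.
Unset Strict Implicit.
Unset Printing Implicit Defensive.
Import Order.TTheory GRing.Theory Num.Theory.
Local Open Scope classical_set_scope.
Local Open Scope ring_scope.

Section CSemigroups.
Variable d : nat.

(* Elements of N^d are row vectors 'rV[nat]_d, with componentwise addition. *)
Implicit Types (A B C S T X : set 'rV[nat]_d) (x y z h k s : 'rV[nat]_d).
Implicit Type le : rel 'rV[nat]_d.

Definition to_ratv x : 'rV[rat]_d := map_mx (fun m : nat => m%:R) x.

(* The index i < n may repeat elements of A, and n = 0 is allowed, so that
   0 always belongs to the cone. *)
Definition cone_span A : set 'rV[nat]_d :=
  [set x | exists (n : nat) (a : 'I_n -> 'rV[nat]_d) (q : 'I_n -> rat),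
    [/\ forall i, A (a i), forall i, 0 <= q i
      & to_ratv x = \sum_(i < n) q i *: to_ratv (a i)]].

Definition positive_integer_cone C : Prop :=
  exists2 A, finite_set A & C = cone_span A.

(* y - x \in X, the difference being taken in Z^d: it lies in X, a subset of
   N^d, exactly when y = x + z for some z in X.  The componentwise truncated
   subtraction of nat would be wrong here. *)
Definition diff_in X y x : Prop := exists2 z, X z & y = x + z.

Definition le_cone C x y : Prop := diff_in C y x.

Definition submonoid S : Prop :=
  S 0 /\ forall x y, S x -> S y -> S (x + y).

Definition finitely_generated S : Prop :=
  exists2 B, finite_set B & S = smallest submonoid B.

Definition gaps C S : set 'rV[nat]_d := C `\` S.

Definition csemigroup C S : Prop :=
  [/\ submonoid S, finitely_generated S, S `<=` C & finite_set (gaps C S)].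

Definition lower_interval C k : set 'rV[nat]_d := [set x | C x /\ le_cone C x k].

Definition positioned C S k : Prop := forall h, gaps C S h -> diff_in S k h.

(* C(S) *)
Definition below_gaps C S : set 'rV[nat]_d :=
  [set x | C x /\ exists2 h, gaps C S h & le_cone C x h].

(* M(S): apart from 0, the gaps h such that 0 is the only s in S with
   h - s \in C.  Requiring h - s \in S instead would be void: if s and h - s
   both lie in the monoid S then so does h, so no gap h admits any such s. *)
Definition minimal_gaps C S : set 'rV[nat]_d :=
  [set h | gaps C S h /\ [set s | S s /\ diff_in C h s] = [set 0]] `|` [set 0].

(* fset_set sends infinite sets to the empty one.  This never matters for a
   C-semigroup S: the three sets below are then finite. *)
Definition card_set X : nat := #|` fset_set X|%fset.

Definition primary_positioned C S : Prop :=
  exists k, [/\ C k, positioned C S k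
    & (card_set (minimal_gaps C S) + card_set (below_gaps C S))%N
      = card_set (lower_interval C k)].

Definition term_order le : Prop :=
  [/\ [/\ reflexive le, antisymmetric le, transitive le & total le],
      forall v, le 0 v
    & forall u v w, le u v -> le (u + w) (v + w)].

(* The maximum of the gaps of S for le; the default value 0 is only taken when
   there is no maximum, i.e. (for a term order and a C-semigroup) when S = C. *)
Definition frobenius C le S : 'rV[nat]_d :=
  xget 0 [set f | gaps C S f /\ forall h, gaps C S h -> le h f].

Definition pseudo_frobenius C S : set 'rV[nat]_d :=
  [set x | gaps C S x /\ forall s, S s -> s != 0 -> S (x + s)].

(* If S = C the left-hand side is empty, so that the default value of
   frobenius plays no role. *)
Definition symmetric_semigroup C S : Prop :=
  exists2 le, term_order le & pseudo_frobenius C S = [set frobenius C le S].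

(* For symmetric T the element frobenius C le T does not depend on the term
   order le; it is the element F(T). *)
Definition uesy C S : Prop :=
  exists T le, [/\ csemigroup C T, symmetric_semigroup C T, term_order le
    & S = T `|` [set frobenius C le T]].

End CSemigroups.

(* Main.v *)
Require Import Defs.
From mathcomp Require Import all_boot all_order all_algebra.
From mathcomp Require Import finmap.
From mathcomp Require Import mathcomp_extra boolp classical_sets functions.
From mathcomp Require Import cardinality.

(** In a symmetric semigroup T with Frobenius element F, every gap h satisfies
    F - h \in T: a largest gap of the form h + s with s \in T is
    pseudo-Frobenius, hence equal to F. If F is the only gap of T, then S = C
    and k = 0 works. Otherwise k = F works: C(S) is contained in the interval
    below F, and the reflection x |-> F - x maps M(S) bijectively onto the rest
    of this interval, the element 0 of M(S) going to F. *)

Section UESY.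
Set Implicit Arguments.
Unset Strict Implicit.
Import GRing.Theory Num.Theory.
Local Open Scope classical_set_scope.
Local Open Scope ring_scope.

Lemma finite_set_max (T : choiceType) (le : rel T) (A : set T) :
  reflexive le -> transitive le -> total le -> finite_set A -> A !=set0 ->
  exists2 m, A m & forall x, A x -> le x m.
Proof.
move=> le_refl le_trans le_total finA [a Aa].
suff max_seq (s : seq T) : {subset s <= A} ->
    exists2 m, A m & forall x, x \in s -> le x m.
  have [|m Am le_m] := max_seq (fset_set A).
    by move=> x; rewrite in_fset_set.
  by exists m => // x Ax; apply: le_m; rewrite in_fset_set // inE.
elim: s => [|b s IHs] sA; first by exists a.
have [|m Am le_m] := IHs; first by move=> x xs; apply: sA; rewrite inE xs orbT.
have Ab : A b by apply: set_mem; apply: sA; rewrite inE eqxx.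
case/orP: (le_total b m) => lebm.
  by exists m => // x; rewrite inE => /predU1P[->|/le_m].
exists b => // x; rewrite inE => /predU1P[->|/le_m lexm]; first exact: le_refl.
exact: le_trans lexm lebm.
Qed.

Variable d : nat.
Implicit Types (A C S T : set 'rV[nat]_d) (x y z h k s F : 'rV[nat]_d).

Lemma rV_nat_addI x : injective (+%R x).
Proof.
move=> y z /matrixP eq_xyz; apply/matrixP => i j.
by have := eq_xyz i j; rewrite !mxE => /addnI.
Qed.

Lemma rV_nat_add_eq0 x y : x + y = 0 -> y = 0.
Proof.
move=> /matrixP xy0; apply/matrixP => i j.
have := xy0 i j; rewrite !mxE => /eqP.
by rewrite addn_eq0 => /andP[_ /eqP].
Qed.

(** Truncated subtraction is the true difference once [k = x + z] is known, so the total function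
    [map2_mx subn F] can serve as the reflection. *)
Lemma map2_subn_addl k x z : k = x + z -> map2_mx subn k x = z.
Proof. by move=> ->; apply/matrixP => i j; rewrite !mxE addKn. Qed.

Lemma to_ratvD x y : to_ratv (x + y) = to_ratv x + to_ratv y.
Proof. by apply/matrixP => i j; rewrite !mxE natrD. Qed.

Lemma to_ratv0 : to_ratv (0 : 'rV[nat]_d) = 0.
Proof. by apply/matrixP => i j; rewrite !mxE. Qed.

(** Sums are handled by concatenating the two families of generators and coefficients. *)
Lemma cone_span_submonoid A : submonoid (cone_span A).
Proof.
split=> [|x y [n [a [q [Aa q0 xE]]]] [m [b [r [Ab r0 yE]]]]].
  exists 0%N, (fun=> 0), (fun=> 0).
  by split=> [[]|[]|] //; rewrite big_ord0 to_ratv0.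
exists (n + m)%N, (fun i : 'I_(n + m) => match fintype.split i with inl j => a j | inr j => b j end),
  (fun i : 'I_(n + m) => match fintype.split i with inl j => q j | inr j => r j end).
split=> [i|i|]; [by case: fintype.split..|].
rewrite to_ratvD xE yE big_split_ord; congr (_ + _); apply: eq_bigr => i _.
  by rewrite (unsplitK (inl i)).
by rewrite (unsplitK (inr i)).
Qed.

(** Each coordinate of [x] is at most that of [k], hence at most their sum [N], so [x] comes from
    one of the finitely many rows over ['I_N.+1]. *)
Lemma finite_lower_interval C k : finite_set (lower_interval C k).
Proof.
pose N := (\sum_(j < d) k ord0 j)%N.
apply: (@sub_finite_set _ _
  [set map_mx (fun i : 'I_N.+1 => i : nat) M | M in [set: 'rV['I_N.+1]_d]]);
  last by apply: finite_image; exact: finite_finset.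
move=> x [_ [z _ kE]]; exists (map_mx inord x) => //.
apply/matrixP => i j; rewrite !mxE inordK // ltnS.
rewrite (ord1 i) {i} /N (bigD1 j) //= kE mxE -addnA.
exact: leq_addr.
Qed.

(** Used with [I] the interval below the Frobenius element, [A] the set C(S), [B] the set M(S) and
    [f] the reflection. *)
Lemma card_setU_image (I : set 'rV[nat]_d) A B (f : 'rV[nat]_d -> 'rV[nat]_d) :
  finite_set A -> finite_set B -> I = A `|` f @` B -> A `&` f @` B = set0 ->
  {in B &, injective f} -> (card_set B + card_set A)%N = card_set I.
Proof.
move=> finA finB -> AB0 f_inj.
have finfB : finite_set (f @` B) by exact: finite_image.
rewrite /card_set fset_setU // cardfsU -fset_setI // AB0 fset_set0 cardfs0 subn0.
rewrite addnC fset_set_image // card_in_imfset //.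
by move=> x y; rewrite !in_fset_set //; exact: f_inj.
Qed.

Lemma term_order_le_add {le : rel 'rV[nat]_d} :
  term_order le -> forall x y, le x (x + y).
Proof. by case=> _ le0 leD x y; have := leD 0 y x (le0 y); rewrite add0r addrC. Qed.

(** If [h + s] were a gap, maximality would give [le (h + s) h], while a term order always gives
    [le h (h + s)]; antisymmetry and cancellation then force [s = 0]. *)
Lemma maximal_gap_pseudo_frobenius C T (le : rel 'rV[nat]_d) h :
  submonoid C -> T `<=` C -> term_order le -> gaps C T h ->
  (forall s, T s -> gaps C T (h + s) -> le (h + s) h) ->
  pseudo_frobenius C T h.
Proof.
move=> [_ CD] TC leT gh hmax; split=> // s Ts /eqP s0.
apply: contrapT => nThs; apply: s0; apply: (@rV_nat_addI h); rewrite addr0.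
have [[_ le_anti _ _] _ _] := leT; apply: le_anti.
rewrite (term_order_le_add leT) andbT; apply: hmax => //.
by split=> //; apply: CD; [case: gh | exact: TC].
Qed.

Lemma symmetric_frobenius C T (le : rel 'rV[nat]_d) :
  submonoid C -> csemigroup C T -> symmetric_semigroup C T -> term_order le ->
  gaps C T (frobenius C le T) /\
  forall h, gaps C T h -> diff_in T (frobenius C le T) h.
Proof.
move=> Cmon [[T0 TD] _ TC finG] [le1 _ PFE] leT.
have [[le_refl le_anti le_trans le_total] _ _] := leT.
(* The singleton is inhabited, so [T] has a gap; the maximum for [le] therefore exists and
   [frobenius C le T] is not the default value. *)
have PF1 : pseudo_frobenius C T (frobenius C le1 T) by rewrite PFE.
have PFF : pseudo_frobenius C T (frobenius C le T).
  have [m gm m_max] := finite_set_max le_refl le_trans le_total finG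
    (ex_intro _ _ (proj1 PF1)).
  have [gF F_max] := xgetPex 0 (ex_intro
    [set f | gaps C T f /\ forall h, gaps C T h -> le h f] m (conj gm m_max)).
  by apply: (maximal_gap_pseudo_frobenius Cmon TC leT gF) => s _; exact: F_max.
split; first by case: PFF.
move=> h gh.
pose A := [set y | gaps C T y /\ diff_in T y h].
have [||m [gm [s Ts mE]] m_max] := finite_set_max (A := A) le_refl le_trans le_total.
- by apply: sub_finite_set finG => y [].
- by exists h; split=> //; exists 0; rewrite ?addr0.
(* A gap [m + t] equals [h + (s + t)] and so stays in [A]: maximality inside [A] suffices. *)
have PFm : pseudo_frobenius C T m.
  apply: (maximal_gap_pseudo_frobenius Cmon TC leT gm) => t Tt gmt.
  by apply: m_max; split=> //; exists (s + t); [exact: TD | rewrite mE addrA].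
exists s => //; rewrite -mE.
(* Both [m] and the Frobenius element for [le] equal the one for [le1]. *)
by move: PFm PFF; rewrite PFE => -> ->.
Qed.

Lemma minimal_gapsP {C S h} : S 0 -> gaps C S h ->
  minimal_gaps C S h <-> forall s, S s -> diff_in C h s -> s = 0.
Proof.
move=> S0 gh; split.
  case=> [[_ ME] s Ss hs|h0]; last by case: gh => _; rewrite h0.
  by have : [set 0] s by rewrite -ME.
move=> hmin; left; split=> //; apply/seteqP; split=> [s [Ss hs]|s ->].
  exact: hmin.
by split=> //; exists h; [case: gh | rewrite add0r].
Qed.

(** With [k = 0] the count reads 1 + 0 = 1: only 0 lies below 0, because a sum in N^d vanishes only
    if both terms do. *)
Lemma primary_positioned_cone C : submonoid C -> primary_positioned C C.
Proof.
move=> [C0 _]; have g0 : gaps C C = set0 by exact: setDv.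
exists 0; split=> //; first by move=> h; rewrite g0.
have -> : minimal_gaps C C = [set 0].
  by apply/seteqP; split=> x; [case=> // -[]; rewrite g0 | right].
have -> : below_gaps C C = set0.
  by apply/seteqP; split=> x // [_ [h]]; rewrite g0.
rewrite /card_set fset_set0 cardfs0 addn0; congr (#|` fset_set _|%fset).
apply/seteqP; split=> [x ->|x [_ [z _]]].
  by split=> //; exists 0; rewrite ?addr0.
by move=> /esym; rewrite addrC => /rV_nat_add_eq0 ->.
Qed.

Section Reflection.
Variables (C T : set 'rV[nat]_d) (F : 'rV[nat]_d).
Hypotheses (Cmon : submonoid C) (Tmon : submonoid T) (TC : T `<=` C).
Hypotheses (gF : gaps C T F) (Fdual : forall h, gaps C T h -> diff_in T F h).
Let S := T `|` [set F].

Let gapsS h : gaps C S h <-> gaps C T h /\ h <> F.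
Proof.
split=> [[Ch nSh]|[[Ch nTh] hF]].
  by split=> [|hF]; [split=> // Th|]; apply: nSh; [left | right].
by split=> // -[].
Qed.

Let S0 : S 0. Proof. by left; case: Tmon. Qed.

(** If [y] were in [T], so would be [F = x + y]; if [y] were [F], then [x] would be 0. *)
Let gap_reflect x y : F = x + y -> T x -> x <> 0 -> C y -> gaps C S y.
Proof.
move=> FE Tx x0 Cy; apply/gapsS; split.
  by split=> // Ty; apply: (proj2 gF); rewrite FE; apply: (proj2 Tmon).
move=> yF; apply: x0; apply: (@rV_nat_addI y).
by rewrite addr0 addrC -FE yF.
Qed.

(** Witnesses correspond under reflection. A gap [h = x + z] of [S] yields [t = F - h] in [T],
    nonzero, with [y = t + z]; conversely a nonzero [s] in [S] with [y = s + z] yields the gap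
    [x + z = F - s]. *)
Let below_gaps_reflect x y : F = x + y -> T x -> x <> 0 -> C y ->
  below_gaps C S x <-> ~ minimal_gaps C S y.
Proof.
move=> FE Tx x0 Cy; have gy := gap_reflect FE Tx x0 Cy.
rewrite (minimal_gapsP S0 gy); split.
  move=> [_ [h gh [z Cz hE]]] ymin.
  have [gTh hF] := proj1 (gapsS h) gh; have [t Tt FhE] := Fdual gTh.
  apply: hF; rewrite FhE (ymin t) ?addr0 //; first by left.
  exists z => //; apply: (@rV_nat_addI x).
  by rewrite -FE FhE hE -addrA (addrC z).
move=> nymin; apply: contrapT => nbx; apply: nymin => s Ss [z Cz yE].
have FsE : F = s + (x + z) by rewrite FE yE addrCA.
apply: contrapT => s0; apply: nbx; split; first exact: TC.
exists (x + z); last by exists z.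
apply: (@gap_reflect s) => //; last by apply: (proj2 Cmon) => //; exact: TC.
(* The case [s = F] is excluded: cancelling [F] would leave [x + z = 0], hence [x = 0]. *)
case: Ss => // sF; case: x0.
have /rV_nat_add_eq0 : z + x = 0.
  by apply: (@rV_nat_addI F); rewrite addr0 {2}FsE sF (addrC z).
by [].
Qed.

Lemma primary_positioned_adjoin_frobenius : primary_positioned C S.
Proof.
have [g0|/set0P[h0 gh0]] := eqVneq (gaps C S) set0.
  suff -> : S = C by exact: primary_positioned_cone.
  apply/seteqP; split=> [x [/TC //|->]|x Cx]; first by case: gF.
  by apply: contrapT => nSx; have : gaps C S x by []; rewrite g0.
have CF : C F by case: gF.
have C0 : C 0 by case: Cmon.
exists F; split=> //.
  by move=> h /gapsS[gh _]; have [t Tt ->] := Fdual gh; exists t => //; left.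
have below_lower : below_gaps C S `<=` lower_interval C F.
  move=> x [Cx [h /gapsS[gh _] [z Cz hE]]]; split=> //.
  have [t Tt FE] := Fdual gh; exists (z + t); last by rewrite FE hE addrA.
  by apply: (proj2 Cmon) => //; exact: TC.
(* The element 0 is kept apart because its reflection [F] is not in [T]; every other member of M(S)
   reflects to a nonzero element of [T], as [below_gaps_reflect] requires. *)
have min_lower y : minimal_gaps C S y ->
    y = 0 \/ exists x, [/\ F = y + x, T x, x <> 0, C y & gaps C S y].
  case=> [[gy _]|->]; [right|by left].
  have [gTy yF] := proj1 (gapsS y) gy; have [x Tx FE] := Fdual gTy.
  exists x; split=> //; last by case: gTy.
  by move=> x0; apply: yF; rewrite FE x0 addr0.
have below_notF : ~ below_gaps C S F.
  move=> [_ [h /gapsS[gh hF] [z _ hE]]]; apply: hF.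
  have [t _ FE] := Fdual gh.
  have /rV_nat_add_eq0 t0 : z + t = 0.
    by apply: (@rV_nat_addI F); rewrite addr0 addrA -hE -FE.
  by rewrite FE t0 addr0.
apply: (card_setU_image (f := map2_mx subn F)).
- exact: sub_finite_set (finite_lower_interval C F).
- apply: sub_finite_set (finite_lower_interval C F) => y /min_lower.
  case=> [->|[x [FE Tx _ Cy _]]]; first by split=> //; exists F; rewrite ?add0r.
  by split=> //; exists x => //; exact: TC.
- apply/seteqP; split=> [x [Cx [y Cy FE]]|x [/below_lower //|]].
    have [bx|nbx] := pselect (below_gaps C S x); [by left | right].
    exists y; last by apply: map2_subn_addl; rewrite FE addrC.
    (* Outside [T], either [x] is [F], the reflection of 0, or [x] is a gap of [S] and lies below
       itself. *)
    have [Tx|nTx] := pselect (T x); last first.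
      have [xF|xF] := pselect (x = F).
        by right; apply: (@rV_nat_addI x); rewrite -FE xF addr0.
      case: nbx; split=> //; exists x; first exact/gapsS.
      by exists 0; rewrite ?addr0.
    (* The gap [h0] puts 0 into C(S); this is where [S] must differ from [C], since the reflection
       [F] of 0 is no gap of [S]. *)
    have [x0|x0] := pselect (x = 0).
      case: nbx; split=> //; exists h0 => //.
      by exists h0; [case: gh0 | rewrite x0 add0r].
    by apply: contrapT => /(below_gaps_reflect FE Tx x0 Cy).
  move=> [y /min_lower[->|[z [FE Tz _ Cy _]]] <-].
    rewrite (map2_subn_addl (esym (add0r F))); split=> //.
    by exists 0; rewrite ?addr0.
  rewrite (map2_subn_addl FE); split; first exact: TC.
  by exists y; rewrite // FE addrC.
- apply/seteqP; split=> // x [bx [y My xE]]; move: xE bx.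
  case: (min_lower y My) => [->|[z [FE Tz z0 Cy _]]].
    by rewrite (map2_subn_addl (esym (add0r F))) => <-.
  rewrite (map2_subn_addl FE) => <-.
  by rewrite (@below_gaps_reflect z y) // FE addrC.
- have lower y : minimal_gaps C S y -> exists x, F = y + x.
    move=> /min_lower[->|[x [FE _ _ _ _]]]; last by exists x.
    by exists F; rewrite add0r.
  move=> y1 y2 /set_mem/lower[x1 E1] /set_mem/lower[x2 E2].
  rewrite (map2_subn_addl E1) (map2_subn_addl E2) => x12.
  by apply: (@rV_nat_addI x1); rewrite addrC -E1 x12 addrC.
Qed.

End Reflection.

End UESY.

Theorem theorem3p2 (d : nat) (hd : (0 < d)%N) (C S : set 'rV[nat]_d)
    (hC : positive_integer_cone C) (hS : uesy C S) :
  primary_positioned C S.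
Proof.
have Cmon : submonoid C by case: hC => A _ ->; exact: cone_span_submonoid.
have [T [le [Tcsg Tsym leT ->]]] := hS.
have [gF Fdual] := symmetric_frobenius Cmon Tcsg Tsym leT.
have [Tmon _ TC _] := Tcsg.
exact: primary_positioned_adjoin_frobenius.
Qed.
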